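(* Let $K$ be a PL sphere on $[m]$ and let $p\neq q$ be vertices of $K$. Consider an incomplete $pq$-square in $K$, i.e. DJ classes $\lambda,\lambda^\alpha,\lambda^\beta\in\mathrm{CM}(K)$ such that $\lambda$ and $\lambda^\alpha$ are $p$-adjacent and $\lambda$ and $\lambda^\beta$ are $q$-adjacent. Then: (1) If there exists no possible missing piece, then the square cannot be completed (there is no missing piece). (2) If there exists more than one possible missing piece for the square, then the missing piece exists and is found among them, and it can be computed explicitly. (3) If there exists only a single possible missing piece for the square, then it is the missing piece of the square, and again it can be computed explicitly.
   Context: Let $K$ be a pure simplicial complex of dimension $n-1$ on vertex set $V$. A (mod 2) characteristic map over $K$ is a map $\lambda:V\to\mathbb{Z}_2^n$ such that whenever $\{i_1,\dots,i_n\}\in K$ is a maximal face, $\lambda(i_1),\dots,\lambda(i_n)$ are linearly independent. $\mathrm{GL}(n,\mathbb{Z}_2)$ acts on these by left multiplication; the orbits are called DJ classes and $\mathrm{CM}(K)$ is the set of DJ classes. (The paper passes freely between a class $\lambda$ and its dual $\bar\lambda$, the class of an $m\times(m-n)$ matrix whose columns form a basis of $\ker\lambda$; these correspond bijectively.) For a vertex $p$ of $K$, the wedge of $K$ at $p$ is the complex on $(V\setminus\{p\})\cup\{p_1,p_2\}$ given by $\mathrm{wed}_p(K)=(I*\mathrm{Lk}_K(p))\cup(\partial I*(K\setminus\{p\}))$, where $I$ is the 1-simplex with vertices $p_1,p_2$, $K\setminus\{p\}=\{\sigma\in K:p\notin\sigma\}$, and $\mathrm{Lk}_K(\sigma)=\{\tau\in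 K:\sigma\cup\tau\in K,\ \sigma\cap\tau=\emptyset\}$. The links of $p_1$ and $p_2$ in $\mathrm{wed}_p(K)$ are copies of $K$. For distinct vertices $p,q$, $\mathrm{wed}_{p,q}(K)=\mathrm{wed}_q(\mathrm{wed}_p(K))$, and the link of each face $\{p_i,q_j\}$ ($i,j\in\{1,2\}$) in it is a copy of $K$. For a characteristic map $\lambda$ over a complex of dimension $n-1$ and a face $\sigma$, $\mathrm{Proj}_\sigma\lambda$ is the characteristic map over the link of $\sigma$ given by $s\mapsto[\lambda(s)]\in\mathbb{Z}_2^n/\langle\lambda(v):v\in\sigma\rangle\cong\mathbb{Z}_2^{n-|\sigma|}$; it is well defined on DJ classes. Write $\mathrm{Proj}_{p}$ and $\mathrm{Proj}_{p,q}$ for $\sigma=\{p\}$ and $\sigma=\{p,q\}$. Two classes $\lambda_1,\lambda_2\in\mathrm{CM}(K)$ are $p$-adjacent if there is $\Lambda\in\mathrm{CM}(\mathrm{wed}_p(K))$ with $\mathrm{Proj}_{p_2}(\Lambda)=\lambda_1$ and $\mathrm{Proj}_{p_1}(\Lambda)=\lambda_2$ (links identified with $K$). One says that there is an edge colored $p$ between them in the prediagram of $K$; the trivial case $\lambda_1=\lambda_2$ is allowed. A square with corners $\lambda,\lambda^\alpha,\lambda^\beta,\lambda^\gamma\in\mathrm{CM}(K)$, with $p$-edges $\lambda\,$–$\,\lambda^\alpha$ and $\lambda^\beta\,$–$\,\lambda^\gamma$ and $q$-edges $\lambda\,$–$\,\lambda^\beta$ and $\lambda^\alpha\,$–$\,\lambda^\gamma$,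 is realizable if there is $\Lambda\in\mathrm{CM}(\mathrm{wed}_{p,q}(K))$ with $\mathrm{Proj}_{p_2,q_2}(\Lambda)=\lambda$, $\mathrm{Proj}_{p_1,q_2}(\Lambda)=\lambda^\alpha$, $\mathrm{Proj}_{p_2,q_1}(\Lambda)=\lambda^\beta$, $\mathrm{Proj}_{p_1,q_1}(\Lambda)=\lambda^\gamma$. For an incomplete $pq$-square $(\lambda,\lambda^\alpha,\lambda^\beta)$, a possible missing piece is a class $\lambda^\gamma\in\mathrm{CM}(K)$ such that $\lambda^\alpha$ and $\lambda^\gamma$ are $q$-adjacent and $\lambda^\beta$ and $\lambda^\gamma$ are $p$-adjacent. The missing piece is a possible missing piece $\lambda^\gamma$ for which the resulting square is realizable; it is unique when it exists. Completing the square means finding the missing piece. *)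

(* Defs.v *)
From HB Require Import structures.
From mathcomp Require Import all_boot all_order all_algebra.
From mathcomp Require Import reals.

Set Implicit Arguments.
Unset Strict Implicit.
Unset Printing Implicit Defensive.

Import Order.TTheory GRing.Theory Num.Theory.
Local Open Scope ring_scope.

(* An abstract simplicial complex whose vertices lie in the finite type V is   *)
(* its set of faces; the empty set is always a face.                           *)

Definition down_closed (V : finType) (K : {set {set V}}) : Prop :=
  set0 \in K /\ forall s t : {set V}, t \in K -> s \subset t -> s \in K.

Definition simplicial_complex_on (V : finType) (K : {set {set V}}) : Prop :=
  down_closed K /\ forall v : V, [set v] \in K.

Definition facet (V : finType) (K : {set {set V}}) (s : {set V}) : bool :=
  maxset (fun t : {set V} => t \in K) s.

(* Pure of dimension n - 1. *)
Definition pure (V : finType) (n : nat) (K : {set {set V}}) : Prop :=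
  forall s : {set V}, facet K s -> #|s| = n.

(* The geometric realization |K|, in barycentric coordinates. *)
Definition realization (R : realType) (V : finType) (K : {set {set V}})
    (t : {ffun V -> R}) : Prop :=
  [/\ forall v, 0 <= t v, \sum_v t v = 1 & [set v | t v != 0] \in K].

Definition simplicial_map (R : realType) (W V : finType)
    (x : W -> {ffun V -> R}) (t : {ffun W -> R}) : {ffun V -> R} :=
  [ffun v => \sum_w t w * x w v].

(* K', with each vertex w placed at the point x w of |K|, subdivides K: each   *)
(* simplex of K' lies in a simplex of K and the induced linear map             *)
(* |K'| -> |K| is a homeomorphism. That map is continuous and |K'| is compact, *)
(* so bijectivity suffices; it maps |K'| into |K| by the first condition.      *)
Definition subdivision (R : realType) (W V : finType) (K' : {set {set W}})
    (x : W -> {ffun V -> R}) (K : {set {set V}}) : Prop :=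
  [/\ down_closed K',
      forall s, s \in K' -> exists2 t, t \in K &
        forall w, w \in s -> realization (powerset t) (x w),
      forall a b, realization K' a -> realization K' b ->
        simplicial_map x a = simplicial_map x b -> a = b
    & forall c, realization K c ->
        exists2 a, realization K' a & simplicial_map x a = c].

Definition simplex_boundary (n : nat) : {set {set 'I_n.+1}} :=
  powerset [set: 'I_n.+1] :\ [set: 'I_n.+1].

(* A PL sphere of dimension n - 1: K and the boundary of the n-simplex are PL  *)
(* homeomorphic, i.e. they have isomorphic subdivisions.                       *)
Definition PL_sphere (R : realType) (V : finType) (n : nat)
    (K : {set {set V}}) : Prop :=
  exists (N : nat) (T : {set {set 'I_N}})
         (x : 'I_N -> {ffun V -> R}) (y : 'I_N -> {ffun 'I_n.+1 -> R}),
    subdivision T x K /\ subdivision T y (simplex_boundary n).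

Definition link (V : finType) (K : {set {set V}}) (s : {set V}) :
    {set {set V}} :=
  [set t : {set V} | (s :|: t \in K) && (s :&: t == set0)].

Definition deletion (V : finType) (K : {set {set V}}) (p : V) :
    {set {set V}} :=
  [set s in K | p \notin s].

Definition join (V : finType) (K L : {set {set V}}) : {set {set V}} :=
  [set s :|: t | s in K, t in L].

(* The vertex set (V \ {p}) u {p1, p2} of the wedge is encoded as option V:    *)
(* p1 is Some p, p2 is None, and a vertex v <> p of V is Some v.               *)
Definition wedge (V : finType) (K : {set {set V}}) (p : V) :
    {set {set option V}} :=
  let I := [set Some p; None] in
  let lift (L : {set {set V}}) : {set {set option V}} :=
    [set [set Some v | v in s] | s : {set V} in L] in
  join (powerset I) (lift (link K [set p]))
    :|: join (powerset I :\ I) (lift (deletion K p)).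

(* wed_q (wed_p K) *)
Definition wedge2 (V : finType) (K : {set {set V}}) (p q : V) :
    {set {set option (option V)}} :=
  wedge (wedge K p) (Some q).

(* The new vertices p_i of the wedge (i = true for p1, i = false for p2) and   *)
(* the identification of K with the link of p_i, in which the role of p is     *)
(* played by the other new vertex.                                             *)
Definition wvertex (V : finType) (p : V) (i : bool) : option V :=
  if i then Some p else None.

Definition wcopy (V : finType) (p : V) (i : bool) (v : V) : option V :=
  if v == p then wvertex p (~~ i) else Some v.

(* The face {p_i, q_j} of wed_{p,q}(K), and the identification of K with its   *)
(* link.                                                                       *)
Definition wface2 (V : finType) (p q : V) (i j : bool) :
    {set option (option V)} :=
  [set Some (wvertex p i); wvertex (Some q) j].

Definition wcopy2 (V : finType) (p q : V) (i j : bool) (v : V) :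
    option (option V) :=
  wcopy (Some q) j (wcopy p i v).

Definition characteristic (V : finType) (n : nat) (K : {set {set V}})
    (lam : {ffun V -> 'cV['F_2]_n}) : bool :=
  [forall (s : {set V} | facet K s), free [seq lam v | v in s]].

Definition dj_class (V : finType) (n : nat) (lam : {ffun V -> 'cV['F_2]_n}) :
    {set {ffun V -> 'cV['F_2]_n}} :=
  [set [ffun v => g *m lam v] | g : 'M['F_2]_n in unitmx].

Definition CM (V : finType) (n : nat) (K : {set {set V}}) :
    {set {set {ffun V -> 'cV['F_2]_n}}} :=
  [set dj_class lam | lam : {ffun V -> 'cV['F_2]_n} & characteristic K lam].

(* Proj_s of the DJ class Lam. The quotient of Z_2^N by the span of the        *)
(* vectors L v, v in s, is given by a surjective matrix P : Z_2^N -> Z_2^k     *)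
(* whose kernel is that span. The projection is a map on the vertices of the   *)
(* link of s, and iota : V -> W identifies V with these vertices.              *)
Definition Proj (V W : finType) (N k : nat) (s : {set W}) (iota : V -> W)
    (Lam : {set {ffun W -> 'cV['F_2]_N}}) : {set {ffun V -> 'cV['F_2]_k}} :=
  [set mu : {ffun V -> 'cV['F_2]_k} |
    [exists L in Lam, exists P : 'M['F_2]_(k, N),
      [&& row_free P,
          [forall x : 'cV['F_2]_N,
            (P *m x == 0) == (x \in <<[seq L v | v in s]>>%VS)]
        & mu == [ffun v => P *m L (iota v)]]]].

Definition adjacent (V : finType) (n : nat) (K : {set {set V}}) (p : V)
    (l1 l2 : {set {ffun V -> 'cV['F_2]_n}}) : Prop :=
  exists Lam : {set {ffun option V -> 'cV['F_2]_n.+1}},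
    [/\ Lam \in CM n.+1 (wedge K p),
        Proj n [set wvertex p false] (wcopy p false) Lam = l1
      & Proj n [set wvertex p true] (wcopy p true) Lam = l2].

Definition incomplete_square (V : finType) (n : nat) (K : {set {set V}})
    (p q : V) (l la lb : {set {ffun V -> 'cV['F_2]_n}}) : Prop :=
  [/\ l \in CM n K, la \in CM n K, lb \in CM n K,
      adjacent K p l la & adjacent K q l lb].

Definition realizable (V : finType) (n : nat) (K : {set {set V}})
    (p q : V) (l la lb lc : {set {ffun V -> 'cV['F_2]_n}}) : Prop :=
  exists Lam : {set {ffun option (option V) -> 'cV['F_2]_n.+2}},
    Lam \in CM n.+2 (wedge2 K p q) /\
    [/\ Proj n (wface2 p q false false) (wcopy2 p q false false) Lam = l,
        Proj n (wface2 p q true false) (wcopy2 p q true false) Lam = la,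
        Proj n (wface2 p q false true) (wcopy2 p q false true) Lam = lb
      & Proj n (wface2 p q true true) (wcopy2 p q true true) Lam = lc].

Definition possible_missing_piece (V : finType) (n : nat) (K : {set {set V}})
    (p q : V) (la lb lc : {set {ffun V -> 'cV['F_2]_n}}) : Prop :=
  [/\ lc \in CM n K, adjacent K q la lc & adjacent K p lb lc].

Definition missing_piece (V : finType) (n : nat) (K : {set {set V}})
    (p q : V) (l la lb lc : {set {ffun V -> 'cV['F_2]_n}}) : Prop :=
  possible_missing_piece K p q la lb lc /\ realizable K p q l la lb lc.

(* Explicit computation of the missing piece from representatives. If the      *)
(* classes of L and A are p-adjacent, then A can be replaced, up to row        *)
(* operations, by a map that agrees with L at p and q and differs from L       *)
(* elsewhere only by multiples of L p. After normalizing A (along p) and B     *)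
(* (along q) in this way, the missing piece is represented by L + A + B: the   *)
(* sum of L, of the p-difference A - L and of the q-difference B - L.          *)
Definition normalized (V : finType) (n : nat) (p q : V)
    (L A : {ffun V -> 'cV['F_2]_n}) : bool :=
  [&& A p == L p, A q == L q & [forall v, A v - L v \in <[L p]>%VS]].

Definition normalize (V : finType) (n : nat) (p q : V)
    (L A : {ffun V -> 'cV['F_2]_n}) : {ffun V -> 'cV['F_2]_n} :=
  odflt A [pick A' in dj_class A | normalized p q L A'].

Definition completion (V : finType) (n : nat) (p q : V)
    (L A B : {ffun V -> 'cV['F_2]_n}) : {ffun V -> 'cV['F_2]_n} :=
  L + normalize p q L A + normalize q p L B.

(* lc is the class computed by [completion], whatever the representatives.     *)
Definition computed (V : finType) (n : nat) (p q : V)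
    (l la lb lc : {set {ffun V -> 'cV['F_2]_n}}) : Prop :=
  forall L A B : {ffun V -> 'cV['F_2]_n}, L \in l -> A \in la -> B \in lb ->
    lc = dj_class (completion p q L A B).

(* Main.v *)
Require Import Defs.
From HB Require Import structures.
From mathcomp Require Import all_boot all_order all_algebra.
From mathcomp Require Import reals.

(** Fix a representative L of l.  The argument is linear algebra over F_2 on
    top of a description of the faces of wedges.

    A face of the wedge at p lies in the closed star of p_1 or of p_2, and the
    link of either is a copy of K.  Hence a map on the wedge is characteristic
    exactly when both of its projections are.  If the projection from p_2 is L,
    the projection from p_1 is obtained by composing with another linear map
    whose kernel is moved from the vector of p_2 to that of p_1.  This adds
    multiples of L p to the vectors of L, so p-adjacency means that the two
    classes have representatives L and L + a L p, with a p = 0; one may moreover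
    take a q = 0 ([adjacent_shear], [shear_adjacent]).  In the same way, the
    corners of a realizable square are represented by L, L + a L p, L + b L q
    and C = L + a L p + b L q, where a and b vanish at p and q; and the square
    with these corners is realizable as soon as all four are characteristic
    ([realizable_square], [square_realizable]).

    The vector a is determined by the class of L + a L p up to adding a linear
    form c in the vectors of L that kills L p and L q ([shear_same_class]), and
    such a change does not affect the class of C ([square_gauge]).  So the class
    of C depends only on l, la, lb, is given by the explicit formula, and is the
    only candidate for the missing piece.

    It remains to see that C is characteristic as soon as there is a possible
    missing piece.  By adjacency to la and to lb, the latter is represented both
    by L + a L p + b' L q and by L + a' L p + b L q.
    - If L p and L q are independent, comparing the L q components shows that
      b' and b differ by a linear form killing L p and L q, so that C represents
      the given possible missing piece ([square_same_class]).
    - If L p = L q, then C is characteristic in any case: a linear relation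
      among the vectors of C on a face gives one for L, for L + a L p or for
      L + b L q ([dependent_square_characteristic]). *)

Set Implicit Arguments.
Unset Strict Implicit.
Unset Printing Implicit Defensive.

Import GRing.Theory.
Local Open Scope ring_scope.

(** * Linear independence over F_2 *)

Lemma F2_neq0 (x : 'F_2) : x != 0 -> x = 1.
Proof. by case: x => [[|[|[]]]] //= i _; apply: val_inj. Qed.

Lemma oppmx_F2 (r k : nat) (A : 'M['F_2]_(r, k)) : - A = A.
Proof. by apply/matrixP => i j; rewrite mxE oppr_pchar2 ?pchar_Fp. Qed.

(** Coefficients are indexed by vertices rather than by positions in a list, so
    that changing the face only changes the range of a sum. *)
Definition indep (W : finType) (N : nat) (L : W -> 'cV['F_2]_N)
    (s : {set W}) : Prop :=
  forall c : W -> 'F_2, \sum_(v in s) c v *: L v = 0 ->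
    forall v, v \in s -> c v = 0.

Section Independence.

Variables (W : finType) (N : nat).
Implicit Types (L : W -> 'cV['F_2]_N) (s t : {set W}).

Lemma indepP L s : reflect (indep L s) (free [seq L v | v in s]).
Proof.
apply: (iffP (@freeP _ _ _ (image_tuple L s))) => [frL c sum0 v sv | indL k sum0 i].
  rewrite -(enum_rankK_in sv sv).
  apply: (frL (fun i => c (enum_val i))).
  rewrite -[RHS]sum0 [RHS]big_enum_val.
  by apply: eq_bigr => i _; rewrite nth_image.
have si := enum_valP i.
rewrite -(enum_valK_in si i); apply: (indL (fun v => k (enum_rank_in si v))) => //.
rewrite -[RHS]sum0 [LHS]big_enum_val.
by apply: eq_bigr => j _; rewrite enum_valK_in nth_image.
Qed.

Lemma indep_sub L s t : s \subset t -> indep L t -> indep L s.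
Proof.
move=> sst indL c sum0 v sv.
have := indL (fun v => if v \in s then c v else 0) _ v (subsetP sst v sv).
rewrite sv; apply; rewrite -[RHS]sum0 (big_setID s) /= (setIidPr sst).
rewrite [X in _ + X]big1 ?addr0; last first.
  by move=> w; rewrite inE => /andP[/negbTE-> _]; rewrite scale0r.
by apply: eq_bigr => w ->.
Qed.

Lemma indep1 L (v : W) : indep L [set v] -> L v != 0.
Proof.
move=> indL; apply/eqP => Lv0.
suff /eqP : 1 = 0 :> 'F_2 by rewrite oner_eq0.
by apply: (indL (fun=> 1) _ v (set11 v)); rewrite big_set1 Lv0 scaler0.
Qed.

Lemma indepT L (M : 'M['F_2]_N) s :
  M \in unitmx -> indep L s -> indep (fun v => M *m L v) s.
Proof.
move=> unitM indL c sum0; apply: indL.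
rewrite -[LHS](mulKmx unitM) mulmx_sumr.
rewrite (eq_bigr (fun v => c v *: (M *m L v))) ?sum0 ?mulmx0 //.
by move=> v _; rewrite -scalemxAr.
Qed.

Lemma span_imageP L s (x : 'cV['F_2]_N) :
  reflect (exists c : W -> 'F_2, x = \sum_(v in s) c v *: L v)
          (x \in <<[seq L v | v in s]>>%VS).
Proof.
apply: (iffP idP) => [xs | [c ->]]; last first.
  apply: memv_suml => v sv; apply/memvZ/memv_span/imageP; by exists v.
have [s0 | [v0 sv0]] := set_0Vmem s.
  move: xs; rewrite s0 /image_mem enum_set0 span_nil memv0 => /eqP->.
  by exists (fun=> 0); rewrite big_set0.
exists (fun v => coord (image_tuple L s) (enum_rank_in sv0 v) x).
rewrite {1}(coord_span xs).
rewrite [RHS]big_enum_val.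
by apply: eq_bigr => i _; rewrite enum_valK_in nth_image.
Qed.

Lemma span_imageU1 L s (u : W) :
  <<[seq L v | v in u |: s]>>%VS = (<[L u]> + <<[seq L v | v in s]>>)%VS.
Proof.
rewrite -span_cons; apply: eq_span => x.
apply/imageP/idP => [[v] | ].
  rewrite !inE => /predU1P[-> -> | sv ->]; first by rewrite eqxx.
  by apply/orP; right; apply/imageP; exists v.
rewrite inE => /predU1P[-> | /imageP[v sv ->]].
  by exists u; rewrite ?setU11.
by exists v; rewrite // setU1r.
Qed.

Lemma indep_functional L s (c : W -> 'F_2) :
  indep L s ->
  exists f : 'rV['F_2]_N, forall v, v \in s -> f *m L v = (c v)%:M.
Proof.
move=> indL; pose M := \matrix_(i < #|s|) (L (enum_val i))^T.
have /row_freeP[B MB] : row_free M.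
  apply: inj_row_free => u uM0; apply/rowP => i; rewrite mxE.
  have si := enum_valP i.
  rewrite -(enum_valK_in si i).
  apply: (indL (fun v => u 0 (enum_rank_in si v))) => //.
  rewrite big_enum_val.
  apply: trmx_inj; rewrite trmx0 -[RHS]uM0 mulmx_sum_row raddf_sum.
  by apply: eq_bigr => j _; rewrite enum_valK_in rowK; apply/matrixP=> a b;
    rewrite !mxE.
exists (B *m (\col_i c (enum_val i)))^T => v sv.
apply: trmx_inj; rewrite trmx_mul trmxK mulmxA tr_scalar_mx.
have -> : (L v)^T = row (enum_rank_in sv v) M.
  by rewrite rowK enum_rankK_in.
rewrite -row_mul MB -row_mul mul1mx [LHS]mx11_scalar !mxE.
by rewrite enum_rankK_in.
Qed.

End Independence.

Lemma addmxx_F2 (r k : nat) (A : 'M['F_2]_(r, k)) : A + A = 0.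
Proof. by rewrite -{2}[A]oppmx_F2 subrr. Qed.

Lemma functional_indep (W : finType) (N : nat) (L : W -> 'cV['F_2]_N)
    (u w : W) (f g : 'rV['F_2]_N) :
  u != w -> f *m L u = 1%:M -> f *m L w = 0 -> g *m L u = 0 ->
  g *m L w = 1%:M -> indep L [set u; w].
Proof.
move=> uw fu fw gu gw c; rewrite big_setU1 ?inE // big_set1 => sum0.
have c0 (h : 'rV['F_2]_N) : h *m (c u *: L u + c w *: L w) = 0.
  by rewrite sum0 mulmx0.
move: (c0 f) (c0 g); rewrite !mulmxDr -!scalemxAr fu fw gu gw !scaler0.
rewrite addr0 add0r => /matrixP/(_ 0 0) + /matrixP/(_ 0 0).
rewrite !mxE !mulr1 => cu cw v; by rewrite !inE => /orP[]/eqP->.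
Qed.

(** A functional that kills z but not u and w exists on a plane over F_2 because
    the third nonzero vector next to u and w is u + w.  This is what makes it
    possible to normalize the coefficient of L p at q to 0 without knowing
    whether L p and L q are equal. *)
Lemma three_faces_functional (W : finType) (N : nat) (L : W -> 'cV['F_2]_N)
    (s : {set W}) (u w z : W) :
  uniq [:: u; w; z] -> u \notin s -> w \notin s -> z \notin s ->
  indep L (u |: (w |: s)) -> indep L (w |: (z |: s)) ->
  indep L (u |: (z |: s)) ->
  exists f : 'rV['F_2]_N, [/\ f *m L u = 1%:M, f *m L w = 1%:M,
    f *m L z = 0 & forall v, v \in s -> f *m L v = 0].
Proof.
rewrite /= !inE negb_or !andbT => /andP[/andP[uw uz] wz] us ws zs iuw iwz iuz.
pose c v : 'F_2 := if v \in [set u; w] then 1 else 0.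
have cu : c u = 1 by rewrite /c !inE eqxx.
have cw : c w = 1 by rewrite /c !inE eqxx orbT.
have cz : c z = 0 by rewrite /c !inE eq_sym (negbTE uz) eq_sym (negbTE wz).
have cs v : v \in s -> c v = 0.
  move=> sv; rewrite /c !inE.
  have /negbTE-> : v != u by apply: contraNneq us => <-.
  by have /negbTE-> : v != w by apply: contraNneq ws => <-.
have [f fE] := indep_functional c iuw.
have fs v : v \in s -> f *m L v = 0.
  by move=> sv; rewrite fE ?cs ?raddf0 // !inE sv !orbT.
have fu : f *m L u = 1%:M by rewrite fE ?cu // !inE eqxx.
have fw : f *m L w = 1%:M by rewrite fE ?cw // !inE eqxx ?orbT.
have [/eqP fz | fz] := boolP (f *m L z == 0); first by exists f.
(* If f z = 1 then a linear relation has an even number of nonzero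
   coefficients at u, w, z, hence omits one of the three. *)
have {}fz : f *m L z = 1%:M.
  rewrite [LHS]mx11_scalar; congr _%:M; apply: F2_neq0.
  by apply: contraNneq fz => fz0; rewrite [f *m _]mx11_scalar fz0 raddf0.
have /(indep_functional c)[g gE] : indep L (u |: (w |: (z |: s))).
  move=> d.
  have wzs : w \notin z |: s by rewrite !inE negb_or wz ws.
  have uzs : u \notin z |: s by rewrite !inE negb_or uz us.
  have uws : u \notin w |: s by rewrite !inE negb_or uw us.
  have uwzs : u \notin w |: (z |: s) by rewrite !inE !negb_or uw uz us.
  rewrite !big_setU1 //= => sum0.
  have : f *m (d u *: L u + (d w *: L w + (d z *: L z
      + \sum_(v in s) d v *: L v))) = 0 by rewrite sum0 mulmx0.
  rewrite !mulmxDr mulmx_sumr big1; last first.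
    by move=> v sv; rewrite -scalemxAr fs ?scaler0.
  rewrite -!scalemxAr fu fw fz addr0 => /matrixP/(_ 0 0).
  rewrite !mxE !mulr1 => dsum v.
  have [dz0 | /F2_neq0 dz1] := eqVneq (d z) 0.
    have := iuw d; rewrite !big_setU1 //=.
    rewrite dz0 scale0r add0r in sum0 => /(_ sum0) d0.
    rewrite !inE => /or4P[/eqP->|/eqP->|/eqP->|sv] //; apply: d0;
      by rewrite !inE ?sv ?eqxx ?orbT.
  have [du0 | /F2_neq0 du1] := eqVneq (d u) 0.
    have := iwz d; rewrite !big_setU1 //=.
    rewrite du0 scale0r add0r in sum0 => /(_ sum0) d0.
    rewrite !inE => /or4P[/eqP->|/eqP->|/eqP->|sv] //; apply: d0;
      by rewrite !inE ?sv ?eqxx ?orbT.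
  have dw0 : d w = 0.
    by apply/eqP; apply: contraT => /F2_neq0 dw1; rewrite du1 dw1 dz1 in dsum.
  have := iuz d; rewrite !big_setU1 //=.
  rewrite dw0 scale0r add0r in sum0 => /(_ sum0) d0.
  rewrite !inE => /or4P[/eqP->|/eqP->|/eqP->|sv] //; apply: d0;
    by rewrite !inE ?sv ?eqxx ?orbT.
exists g; split=> [|||v sv]; rewrite gE ?cu ?cw ?cz ?cs ?raddf0 //;
  by rewrite !inE ?sv ?eqxx ?orbT.
Qed.

(** * Quotients of F_2^N as surjective matrices *)

Definition quotient_by (N k : nat) (P : 'M['F_2]_(k, N))
    (U : {vspace 'cV['F_2]_N}) : Prop :=
  row_free P /\ forall x, (P *m x == 0) = (x \in U).

(** The projection of a characteristic map is characteristic, with its converse: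
    a face of the star of s is independent exactly when s is independent and the
    rest of the face is independent modulo s. *)
Lemma quotient_indep (V W : finType) (N k : nat) (L : W -> 'cV['F_2]_N)
    (P : 'M['F_2]_(k, N)) (s : {set W}) (t : {set V}) (iota : V -> W) :
  injective iota -> (forall v, iota v \notin s) ->
  quotient_by P <<[seq L w | w in s]>>%VS ->
  indep L (s :|: iota @: t) <->
  indep L s /\ indep (fun v => P *m L (iota v)) t.
Proof.
move=> iota_inj iota_s [_ kerP].
have dis : [disjoint s & iota @: t].
  apply/pred0P => w /=; apply/negP => /andP[sw /imsetP[v _ wE]].
  by have := iota_s v; rewrite -wE sw.
have sumE (c : W -> 'F_2) : \sum_(w in s :|: iota @: t) c w *: L w =
    \sum_(w in s) c w *: L w + \sum_(v in t) c (iota v) *: L (iota v).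
  rewrite (eq_bigl [predU s & iota @: t]) => [|w]; last by rewrite !inE.
  rewrite bigU //=; congr (_ + _).
  by rewrite big_imset //=; apply: in2W.
split=> [indL | [inds indt] c].
  split=> [|c sum0 v tv]; first by apply: indep_sub indL; apply: subsetUl.
  have : \sum_(v in t) c v *: L (iota v) \in <<[seq L w | w in s]>>%VS.
    rewrite -kerP mulmx_sumr -[X in _ == X]sum0; apply/eqP.
    by apply: eq_bigr => x _; rewrite scalemxAr.
  case/span_imageP=> d dE.
  (* On the image of iota take the coefficients c, elsewhere those of d. *)
  pose e w := if [pick v | iota v == w] is Some v then c v else d w.
  have eI x : e (iota x) = c x.
    rewrite /e; case: pickP => [y /eqP/iota_inj-> // | /(_ x)].
    by rewrite eqxx.
  rewrite -eI; apply: indL; last by rewrite inE imset_f ?orbT.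
  rewrite sumE -[RHS](addmxx_F2 (\sum_(v in t) c v *: L (iota v))) {1}dE.
  congr (_ + _); apply: eq_bigr => w; last by rewrite eI.
  rewrite /e; case: pickP => // x /eqP <- sx.
  by have := iota_s x; rewrite sx.
rewrite sumE => sum0.
have ct v : v \in t -> c (iota v) = 0.
  apply: (indt (c \o iota)).
  have Ps : P *m (\sum_(w in s) c w *: L w) = 0.
    by apply/eqP; rewrite kerP; apply/span_imageP; exists c.
  rewrite -[RHS](mulmx0 _ P) -sum0 mulmxDr Ps add0r mulmx_sumr.
  by apply: eq_bigr => x _; rewrite -scalemxAr.
move=> w; rewrite inE => /orP[|/imsetP[v tv ->]]; last exact: ct.
apply: inds; rewrite -[RHS]sum0 [X in _ + X]big1 ?addr0 // => x tx.
by rewrite ct ?scale0r.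
Qed.

Lemma line_addP (N : nat) (w x : 'cV['F_2]_N) (U : {vspace 'cV['F_2]_N}) :
  reflect (exists (c : 'F_2) (y : 'cV['F_2]_N), y \in U /\ x = c *: w + y)
          (x \in (<[w]> + U)%VS).
Proof.
apply: (iffP memv_addP) => [[_ /vlineP[c ->] [y Uy ->]] | [c [y [Uy ->]]]].
  by exists c, y.
by exists (c *: w); [apply/memvZ/memv_line | exists y].
Qed.

(** Moving one kernel vector: the rank one correction cancels P w, and it
    vanishes on U.  In characteristic 2, a vector x killed by the new map
    satisfies P (x + f(x) w) = 0. *)
Lemma quotient_shear (N k : nat) (P : 'M['F_2]_(k, N)) (f : 'rV['F_2]_N)
    (u w : 'cV['F_2]_N) (U : {vspace 'cV['F_2]_N}) :
  quotient_by P (<[u]> + U)%VS -> f *m u = 1%:M -> f *m w = 1%:M ->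
  (forall x, x \in U -> f *m x = 0) ->
  quotient_by (P + P *m w *m f) (<[w]> + U)%VS.
Proof.
case=> /row_freeP[B PB] kerP fu fw fU.
have Pu : P *m u = 0.
  by apply/eqP; rewrite kerP (subvP (addvSl _ _)) ?memv_line.
have PU x : x \in U -> P *m x = 0.
  by move=> Ux; apply/eqP; rewrite kerP (subvP (addvSr _ _)).
split=> [|x].
  (* The right inverse B of P, corrected so that f vanishes on its image. *)
  apply/row_freeP; exists (B - u *m (f *m B)).
  rewrite mulmxBr !mulmxDl PB !mulmxA Pu !mul0mx add0r -(mulmxA _ f u) fu.
  by rewrite mulmx1 addrK.
apply/eqP/idP => [Qx | /line_addP[c [y [Uy ->]]]]; last first.
  rewrite mulmxDl !mulmxDr (PU y Uy) -!mulmxA (fU y Uy) !mulmx0 !addr0.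
  by rewrite -!scalemxAr fw mulmx1 addmxx_F2.
have : x + ((f *m x) 0 0) *: w \in (<[u]> + U)%VS.
  rewrite -kerP mulmxDr -scalemxAr -mul_mx_scalar -mx11_scalar mulmxA.
  by rewrite -mulmxDl Qx.
case/line_addP=> c [y [Uy xE]].
have c0 : c = 0.
  have := congr1 (mulmx f) xE.
  rewrite !mulmxDr (fU y Uy) -!scalemxAr fw fu scalemx1 -mx11_scalar addmxx_F2.
  by rewrite addr0 => /matrixP/(_ 0 0); rewrite !mxE mulr1.
rewrite c0 scale0r add0r in xE.
apply/line_addP; exists (- (f *m x) 0 0), y; split=> //.
by rewrite scaleNr -xE [RHS]addrC addrK.
Qed.

(** * DJ classes and their projections *)

Section Classes.

Variables (V W : finType) (k N : nat).
Implicit Types (L M : {ffun V -> 'cV['F_2]_k}) (Lam : {ffun W -> 'cV['F_2]_N}).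

Lemma dj_classP L M :
  reflect (exists2 g, g \in unitmx & forall v, M v = g *m L v) (M \in dj_class L).
Proof.
apply: (iffP imsetP) => [[g gu ->] | [g gu gE]]; exists g => //.
  by move=> v; rewrite ffunE.
by apply/ffunP => v; rewrite ffunE.
Qed.

Lemma mem_dj_class L : L \in dj_class L.
Proof.
by apply/dj_classP; exists 1%:M; rewrite ?unitmx1 // => v; rewrite mul1mx.
Qed.

Lemma dj_class_eq L M : M \in dj_class L -> dj_class M = dj_class L.
Proof.
case/dj_classP=> g gu gE; apply/setP => X; apply/dj_classP/dj_classP.
  by case=> h hu hE; exists (h *m g); rewrite ?unitmx_mul ?hu // => v;
    rewrite hE gE mulmxA.
case=> h hu hE; exists (h *m invmx g); rewrite ?unitmx_mul ?hu ?unitmx_inv //.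
by move=> v; rewrite hE gE mulmxA mulmxKV.
Qed.

End Classes.

Section Projection.

Variables (V W : finType) (k N : nat).
Implicit Types (L M : {ffun V -> 'cV['F_2]_k}) (Lam : {ffun W -> 'cV['F_2]_N}).
Variables (s : {set W}) (iota : V -> W).

Lemma quotient_by_unique (P Q : 'M['F_2]_(k, N)) U :
  quotient_by P U -> quotient_by Q U -> exists2 g, g \in unitmx & Q = g *m P.
Proof.
case=> Pfree kerP [Qfree kerQ].
have /submxP[g QE] : (Q <= P)%MS.
  rewrite submxE; apply/eqP/matrixP => i j.
  have : P *m col j (cokermx P) == 0 by rewrite colE mulmxA mulmx_coker mul0mx.
  rewrite kerP -kerQ colE mulmxA -colE => /eqP/colP/(_ i).
  by rewrite !mxE.
exists g => //; rewrite -row_free_unit /row_free eqn_leq rank_leq_row /=.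
move: Qfree; rewrite /row_free => /eqP kE.
by rewrite -[X in (X <= _)%N]kE QE mxrankM_maxl.
Qed.

(** Allows passing from another representative of a DJ class, which has a
    different kernel to project from, to a fixed one. *)
Lemma quotient_mulr (P : 'M['F_2]_(k, N)) (h : 'M['F_2]_N) (Lam : W -> 'cV['F_2]_N) :
  h \in unitmx ->
  quotient_by P <<[seq h *m Lam w | w in s]>>%VS ->
  quotient_by (P *m h) <<[seq Lam w | w in s]>>%VS.
Proof.
move=> hu [Pfree kerP]; split=> [|x].
  by rewrite /row_free mxrankMfree ?row_free_unit.
rewrite -mulmxA kerP.
have sumE (c : W -> 'F_2) : \sum_(w in s) c w *: (h *m Lam w) =
    h *m (\sum_(w in s) c w *: Lam w).
  by rewrite mulmx_sumr; apply: eq_bigr => w _; rewrite scalemxAr.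
apply/span_imageP/span_imageP => -[c cE]; exists c; last by rewrite cE sumE.
by apply: (can_inj (mulKmx hu)); rewrite cE sumE.
Qed.

(** The projection does not depend on the representative or on the matrix of the
    quotient map, since two such matrices differ by an invertible factor. *)
Lemma Proj_dj_class (P : 'M['F_2]_(k, N)) Lam :
  quotient_by P <<[seq Lam w | w in s]>>%VS ->
  Proj k s iota (dj_class Lam) = dj_class [ffun v => P *m Lam (iota v)].
Proof.
move=> quoP; apply/setP => mu; rewrite inE.
apply/existsP/dj_classP => [[L /andP[/dj_classP[h hu LE]]] | [g gu muE]].
  case/existsP=> Q /and3P[Qfree /forallP kerQ /eqP muE].
  have quoQ : quotient_by Q <<[seq h *m Lam w | w in s]>>%VS.
    split=> // x; rewrite (eqP (kerQ x)); congr (_ \in <<_>>%VS).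
    exact: eq_map.
  have [g gu gE] := quotient_by_unique quoP (quotient_mulr hu quoQ).
  by exists g => // v; rewrite muE !ffunE LE mulmxA gE mulmxA.
case: quoP => Pfree kerP.
exists Lam; rewrite mem_dj_class; apply/existsP; exists (g *m P).
apply/and3P; split.
- by rewrite /row_free mxrankMfree // -/(row_free g) row_free_unit.
- apply/forallP => x; rewrite -kerP -mulmxA; apply/eqP.
  by apply/eqP/eqP => [| ->]; rewrite ?mulmx0 // => /(canRL (mulKmx gu)) ->;
    rewrite mulmx0.
- by apply/eqP/ffunP => v; rewrite muE !ffunE mulmxA.
Qed.

Lemma Proj_representative Lam L :
  Proj k s iota (dj_class Lam) = dj_class L ->
  exists (M : {ffun W -> 'cV['F_2]_N}) (P : 'M['F_2]_(k, N)),
    [/\ dj_class M = dj_class Lam, quotient_by P <<[seq M w | w in s]>>%VS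
      & forall v, L v = P *m M (iota v)].
Proof.
move=> ProjE; have := mem_dj_class L; rewrite -ProjE inE.
case/existsP=> M /andP[MLam] /existsP[P /and3P[Pfree /forallP kerP /eqP LE]].
exists M, P; split=> [||v]; first exact: dj_class_eq.
  by split=> // x; apply: (eqP (kerP x)).
by rewrite LE ffunE.
Qed.

End Projection.

Lemma eq_indep (W : finType) (N : nat) (L M : W -> 'cV['F_2]_N) (s : {set W}) :
  L =1 M -> indep L s -> indep M s.
Proof.
move=> LM indL c sum0; apply: indL; rewrite -[RHS]sum0.
by apply: eq_bigr => v _; rewrite LM.
Qed.

(** * Faces of wedges *)

(** Independence passes to subsets, so it may be tested on all faces instead of
    facets; the faces of a wedge have the simpler description. *)
Lemma characteristicP (V : finType) (n : nat) (K : {set {set V}})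
    (L : {ffun V -> 'cV['F_2]_n}) :
  characteristic K L <-> forall s, s \in K -> indep L s.
Proof.
split=> [/forall_inP charL s sK | indL].
  have [t tmax st] := maxset_exists sK.
  exact: indep_sub st (elimT (indepP L t) (charL t tmax)).
by apply/forall_inP => s /maxsetp sK; apply/indepP/indL.
Qed.

Lemma characteristic_dj (V : finType) (n : nat) (K : {set {set V}})
    (L M : {ffun V -> 'cV['F_2]_n}) :
  M \in dj_class L -> characteristic K L -> characteristic K M.
Proof.
case/dj_classP=> g gu gE /characteristicP indL.
apply/characteristicP => s sK; apply: (@eq_indep _ _ (fun v => g *m L v)) => //.
by apply/indepT/indL.
Qed.

Lemma mem_CM (V : finType) (n : nat) (K : {set {set V}})
    (L : {ffun V -> 'cV['F_2]_n}) : characteristic K L -> dj_class L \in CM n K.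
Proof. by move=> charL; apply/imsetP; exists L; rewrite ?inE. Qed.

Lemma CM_characteristic (V : finType) (n : nat) (K : {set {set V}})
    (l : {set {ffun V -> 'cV['F_2]_n}}) (L : {ffun V -> 'cV['F_2]_n}) :
  l \in CM n K -> L \in l -> characteristic K L /\ l = dj_class L.
Proof.
case/imsetP=> M; rewrite inE => charM -> LM; split; last exact/esym/dj_class_eq.
exact: characteristic_dj charM.
Qed.

Lemma wcopy_inj (V : finType) (p : V) i : injective (wcopy p i).
Proof.
move=> v w; rewrite /wcopy /wvertex.
by case: (eqVneq v p) => [->|vp]; case: (eqVneq w p) => [->|wp];
  case: i => //= -[] //;
  move=> E; rewrite E eqxx in vp wp *.
Qed.

Section WedgeFaces.

Variables (V : finType) (p : V).
Implicit Types (K : {set {set V}}) (t : {set V}).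

Lemma wcopy_neq i v : wcopy p i v != wvertex p i.
Proof.
by rewrite /wcopy /wvertex; case: (eqVneq v p) => [_|vp]; case: i.
Qed.

Lemma wcopy_p i : wcopy p i p = wvertex p (~~ i).
Proof. by rewrite /wcopy eqxx. Qed.

Lemma wcopy_imset i t : p \notin t -> wcopy p i @: t = Some @: t.
Proof.
move=> pt; apply: eq_in_imset => v tv; rewrite /wcopy.
by case: eqP => // vp; rewrite -vp tv in pt.
Qed.

Lemma wedge_face K i t : t \in K -> wvertex p i |: wcopy p i @: t \in wedge K p.
Proof.
move=> tK; have [pt | pt] := boolP (p \in t).
  apply/setUP; left; apply/imset2P.
  exists [set Some p; None] (Some @: (t :\ p)).
  - by rewrite inE.
  - apply/imset_f; rewrite inE setD1K // tK /=.
    by rewrite setI_eq0 disjoints1 !inE eqxx.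
  rewrite -{1}(setD1K pt) imsetU1 wcopy_p wcopy_imset ?setD11 // setUA.
  by congr (_ :|: _); case: i; rewrite //= setUC.
apply/setUP; right; apply/imset2P.
exists [set wvertex p i] (Some @: t); last by rewrite wcopy_imset.
- rewrite !inE sub1set !inE; case: i => /=; rewrite ?eqxx ?orbT andbT.
    by apply/eqP => /setP/(_ None); rewrite !inE.
  by apply/eqP => /setP/(_ (Some p)); rewrite !inE eqxx.
- by apply/imset_f; rewrite !inE tK.
Qed.

(** Faces that contain p_1 lie in the star of p_1; a face with neither new
    vertex lies in both stars. *)
Lemma wedge_cover K s : s \in wedge K p ->
  exists i t, t \in K /\ s \subset wvertex p i |: wcopy p i @: t.
Proof.
case/setUP => /imset2P[A B].
  rewrite inE => AI /imsetP[t]; rewrite inE => /andP[tK] dis -> ->.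
  exists true, (p |: t); split=> //; apply/subsetP => x.
  rewrite setI_eq0 disjoints1 in dis.
  rewrite imsetU1 wcopy_p wcopy_imset // !inE orbA.
  by case/orP=> [/(subsetP AI) | ->]; rewrite ?orbT // !inE => ->.
(* A proper subset A of the new edge lies in p_1 or in p_2. *)
rewrite !inE => /andP[AnI AI] /imsetP[t]; rewrite inE => /andP[tK pt] -> ->.
exists (None \notin A), t; split=> //; apply/subsetP => x.
rewrite !inE => /orP[Ax | /imsetP[v tv ->]]; last first.
  by rewrite wcopy_imset // imset_f ?orbT.
apply/orP; left; have := subsetP AI x Ax; rewrite !inE.
case/orP=> /eqP xE; rewrite xE in Ax *; last by rewrite Ax.
have [NA|] := boolP (None \in A) => //=.
case/eqP: AnI; apply/eqP; rewrite eqEsubset AI; apply/subsetP => y.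
by rewrite !inE => /orP[]/eqP->.
Qed.

Lemma characteristic_wedge (n : nat) K (Lam : {ffun option V -> 'cV['F_2]_n}) :
  characteristic (wedge K p) Lam <->
  forall i t, t \in K -> indep Lam (wvertex p i |: wcopy p i @: t).
Proof.
split=> [/characteristicP charL i t tK | indL]; first exact/charL/wedge_face.
apply/characteristicP => s /wedge_cover[i [t [tK sub]]].
exact: indep_sub sub (indL i t tK).
Qed.

Variable q : V.
Hypothesis pq : p != q.

Lemma wcopy2_inj i j : injective (wcopy2 p q i j).
Proof. by move=> v w /wcopy_inj/wcopy_inj. Qed.

Lemma wcopy2E i j v : wcopy2 p q i j v =
  if v == p then Some (wvertex p (~~ i))
  else if v == q then wvertex (Some q) (~~ j) else Some (Some v).
Proof.
rewrite /wcopy2 /wcopy; case: (v == p); last by rewrite (inj_eq Some_inj).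
by case: i => //=; rewrite (inj_eq Some_inj) (negbTE pq).
Qed.

Lemma wcopy2_notin i j v : wcopy2 p q i j v \notin wface2 p q i j.
Proof.
rewrite wcopy2E !inE negb_or.
case: (eqVneq v p) => [_ | vp].
  by case: i; case: j; rewrite //= ?(inj_eq Some_inj) ?(negbTE pq).
case: (eqVneq v q) => [_ | vq].
  by case: i; case: j; rewrite //= ?(inj_eq Some_inj) 1?eq_sym ?(negbTE pq).
by case: i; case: j; rewrite //= ?(inj_eq Some_inj) ?vp ?vq.
Qed.
End WedgeFaces.

Lemma characteristic_wedge2 (V : finType) (p q : V) (n : nat) (K : {set {set V}})
    (Lam : {ffun option (option V) -> 'cV['F_2]_n}) :
  p != q ->
  characteristic (wedge2 K p q) Lam <->
  forall i j t, t \in K ->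
    indep Lam (wface2 p q i j :|: wcopy2 p q i j @: t).
Proof.
move=> pq.
have faceE i j (t : {set V}) :
    wvertex (Some q) j |: wcopy (Some q) j @: (wvertex p i |: wcopy p i @: t)
    = wface2 p q i j :|: wcopy2 p q i j @: t.
  have -> : wcopy2 p q i j @: t = wcopy (Some q) j @: (wcopy p i @: t).
    exact: imset_comp.
  rewrite imsetU1 setUA [X in X :|: _]setUC; congr (_ |: _ :|: _).
  rewrite /wcopy; case: i => //=.
  by rewrite (inj_eq Some_inj) (negbTE pq).
split=> [/characteristic_wedge indL i j t tK | indL].
  by rewrite -faceE; apply/indL/wedge_face.
apply/characteristic_wedge => j s /wedge_cover[i [t [tK sub]]].
apply: indep_sub (indL i j t tK); rewrite -faceE.
exact/setUS/imsetS.
Qed.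

Lemma wcopy_false (V : finType) (p v : V) : wcopy p false v = Some v.
Proof. by rewrite /wcopy; case: eqP => //= ->. Qed.

Lemma indep_set1 (W : finType) (N : nat) (L : W -> 'cV['F_2]_N) (v : W) :
  L v != 0 -> indep L [set v].
Proof.
move=> Lv c; rewrite big_set1 => /eqP; rewrite scaler_eq0 (negbTE Lv) orbF.
by move=> /eqP cv w /set1P->.
Qed.

Lemma indep_set2 (W : finType) (N : nat) (L : W -> 'cV['F_2]_N) (u w : W) :
  L u != 0 -> L w != 0 -> L u != L w -> indep L [set u; w].
Proof.
move=> Lu Lw Luw c.
have uw : u != w by apply: contra_neq Luw => ->.
rewrite big_setU1 ?inE // big_set1 /= => sum0.
suff [cu cw] : c u = 0 /\ c w = 0 by move=> v; rewrite !inE => /orP[]/eqP->.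
move: sum0; have [-> | /F2_neq0->] := eqVneq (c u) 0;
  have [-> | /F2_neq0->] := eqVneq (c w) 0.
- by [].
- by rewrite scale0r scale1r add0r => /eqP; rewrite (negbTE Lw).
- by rewrite scale0r scale1r addr0 => /eqP; rewrite (negbTE Lu).
- by rewrite !scale1r => /eqP; rewrite addr_eq0 oppmx_F2 (negbTE Luw).
Qed.

(** * Characteristic maps over wedges *)

Lemma quotient_step (W : finType) (N k : nat) (L : W -> 'cV['F_2]_N)
    (P : 'M['F_2]_(k, N)) (f : 'rV['F_2]_N) (s : {set W}) (u w : W) :
  quotient_by P <<[seq L v | v in u |: s]>>%VS ->
  f *m L u = 1%:M -> f *m L w = 1%:M ->
  (forall v, v \in s -> f *m L v = 0) ->
  quotient_by (P + P *m L w *m f) <<[seq L v | v in w |: s]>>%VS.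
Proof.
rewrite !span_imageU1 => quoP fu fw fs; apply: quotient_shear quoP fu fw _.
move=> x /span_imageP[c ->]; rewrite mulmx_sumr big1 // => v sv.
by rewrite -scalemxAr fs ?scaler0.
Qed.

Definition shear (V : finType) (n : nat) (L : {ffun V -> 'cV['F_2]_n})
    (x : 'cV['F_2]_n) (a : V -> 'F_2) : {ffun V -> 'cV['F_2]_n} :=
  [ffun v => L v + a v *: x].

(** The corners of a square: i says whether the p-edge at L has been followed,
    j whether the q-edge has. *)
Definition square (V : finType) (n : nat) (L : {ffun V -> 'cV['F_2]_n})
    (p q : V) (a b : V -> 'F_2) (i j : bool) : {ffun V -> 'cV['F_2]_n} :=
  [ffun v => L v + (a v *: L p) *+ i + (b v *: L q) *+ j].

Section WedgeMaps.

Variables (V : finType) (n N : nat) (K : {set {set V}}) (p q : V).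
Variables (L : {ffun V -> 'cV['F_2]_n}) (P : 'M['F_2]_(n, N)).
Variables (f g : 'rV['F_2]_N) (a b : V -> 'F_2).

(** Here P is the quotient from p_2 and f is a coordinate equal to 1 on both new
    vertices, so P + L p f is a quotient from p_1.  The coordinate f of a vertex
    v is the coefficient a v, except at p, where the vertex is p_1 and f is 1. *)
Lemma wedge_shear (Lam : {ffun option V -> 'cV['F_2]_N}) :
  quotient_by P <<[seq Lam w | w in [set wvertex p false]]>>%VS ->
  (forall v, L v = P *m Lam (Some v)) ->
  f *m Lam None = 1%:M -> a p = 0 ->
  (forall v, f *m Lam (Some v) = (a v + (v == p)%:R)%:M) ->
  [/\ Proj n [set wvertex p false] (wcopy p false) (dj_class Lam) = dj_class L,
      Proj n [set wvertex p true] (wcopy p true) (dj_class Lam)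
        = dj_class (shear L (L p) a)
    & characteristic (wedge K p) Lam <->
      characteristic K L /\ characteristic K (shear L (L p) a)].
Proof.
move=> quoP LE f2 ap fE.
have f1 : f *m Lam (Some p) = 1%:M by rewrite fE ap eqxx add0r.
have P2 : P *m Lam None = 0.
  by case: quoP => _ kerP; apply/eqP; rewrite kerP; apply/memv_span/image_f/set11.
pose M i := if i then shear L (L p) a else L.
pose Q i := if i then P + L p *m f else P.
have quoQ i : quotient_by (Q i) <<[seq Lam w | w in [set wvertex p i]]>>%VS.
  case: i => //; rewrite /Q LE -[[set _]]setU0.
  apply: quotient_step f2 f1 _; first by rewrite setU0.
  by move=> v; rewrite inE.
have ME i : M i = [ffun v => Q i *m Lam (wcopy p i v)].
  apply/ffunP => v; rewrite ffunE; case: i => /=; last by rewrite wcopy_false.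
  rewrite ffunE mulmxDl /wcopy; have [->|vp] := eqVneq v p.
    by rewrite ap scale0r P2 -mulmxA f2 mulmx1 addrC.
  by rewrite -LE -mulmxA fE (negbTE vp) addr0 mul_mx_scalar.
have indp i : indep Lam [set wvertex p i].
  apply: indep_set1; apply/eqP => L0.
  have : f *m Lam (wvertex p i) = 1%:M by case: (i).
  by rewrite L0 mulmx0 => /matrixP/(_ 0 0)/eqP; rewrite !mxE eq_sym oner_eq0.
have indE i (t : {set V}) :
    indep Lam (wvertex p i |: wcopy p i @: t) <-> indep (M i) t.
  have := quotient_indep t (@wcopy_inj V p i) _ (quoQ i).
  move=> /(_ _)[|to from]; first by move=> v; rewrite inE wcopy_neq.
  rewrite ME; split=> [/to[_] | ind].
    by apply: eq_indep => v; rewrite ffunE.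
  apply: from; split=> //; apply: eq_indep ind => v; by rewrite ffunE.
split.
- by rewrite (Proj_dj_class _ (quoQ false)) -ME.
- by rewrite (Proj_dj_class _ (quoQ true)) -ME.
split=> [/characteristic_wedge ind | [/characteristicP indL /characteristicP indS]].
  by split; apply/characteristicP => t tK; [apply/(indE false)|apply/(indE true)];
    apply: ind.
by apply/characteristic_wedge => -[] t tK; apply/indE; [apply: indS | apply: indL].
Qed.

Lemma mulmx_mulb (m1 m2 m3 : nat) (A : 'M['F_2]_(m1, m2))
    (B : 'M_(m2, m3)) (i : bool) :
  (A *+ i) *m B = (A *m B) *+ i.
Proof. by case: i; rewrite // !mulr0n mul0mx. Qed.

(** The same with two independent coordinates f and g, dual to p_2 and q_2. *)
Lemma wedge2_square (Lam : {ffun option (option V) -> 'cV['F_2]_N}) :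
  p != q ->
  quotient_by P <<[seq Lam w | w in wface2 p q false false]>>%VS ->
  (forall v, L v = P *m Lam (Some (Some v))) ->
  [/\ a p = 0, a q = 0, b p = 0 & b q = 0] ->
  f *m Lam (Some None) = 1%:M -> f *m Lam None = 0 ->
  g *m Lam (Some None) = 0 -> g *m Lam None = 1%:M ->
  (forall v, f *m Lam (Some (Some v)) = (a v + (v == p)%:R)%:M) ->
  (forall v, g *m Lam (Some (Some v)) = (b v + (v == q)%:R)%:M) ->
  (forall i j, Proj n (wface2 p q i j) (wcopy2 p q i j) (dj_class Lam)
     = dj_class (square L p q a b i j)) /\
  (characteristic (wedge2 K p q) Lam <->
   forall i j, characteristic K (square L p q a b i j)).
Proof.
move=> pq quoP LE [ap aq bp bq] fp2 fq2 gp2 gq2 fE gE.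
have qp : q != p by rewrite eq_sym.
have fp i : f *m Lam (Some (wvertex p i)) = 1%:M.
  by case: i; rewrite // fE ap eqxx add0r.
have fq j : f *m Lam (wvertex (Some q) j) = 0.
  by case: j; rewrite // fE aq (negbTE qp) addr0 raddf0.
have gp i : g *m Lam (Some (wvertex p i)) = 0.
  by case: i; rewrite // gE bp (negbTE pq) addr0 raddf0.
have gq j : g *m Lam (wvertex (Some q) j) = 1%:M.
  by case: j; rewrite // gE bq eqxx add0r.
have [Pp2 Pq2] : P *m Lam (Some None) = 0 /\ P *m Lam None = 0.
  by case: quoP => _ kerP; split; apply/eqP; rewrite kerP; apply/memv_span/image_f;
    rewrite !inE.
pose M := square L p q a b.
pose Q (i j : bool) := P + (L q *m g) *+ j + (L p *m f) *+ i.
have quoQ i j : quotient_by (Q i j) <<[seq Lam w | w in wface2 p q i j]>>%VS.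
  have quo0 : quotient_by (Q false j) <<[seq Lam w | w in wface2 p q false j]>>%VS.
    rewrite /Q mulr0n addr0; case: j; last by rewrite mulr0n addr0.
    rewrite /wface2 setUC mulr1n LE.
    apply: quotient_step (gq false) (gq true) _; first by rewrite setUC.
    by move=> v /set1P->; apply: gp.
  case: i => //.
  have -> : Q true j = Q false j + L p *m f by rewrite /Q mulr0n addr0.
  have -> : L p = Q false j *m Lam (Some (wvertex p true)).
    by rewrite /Q mulr0n addr0 mulmxDl mulmx_mulb -mulmxA gp mulmx0 mul0rn addr0 LE.
  apply: quotient_step (fp false) (fp true) _ => // v /set1P->; exact: fq.
have ME i j : M i j = [ffun v => Q i j *m Lam (wcopy2 p q i j v)].
  apply/ffunP => v; rewrite !ffunE /Q 2!mulmxDl !mulmx_mulb -!mulmxA wcopy2E //.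
  have [->|vp] := eqVneq v p.
    rewrite fp gp ap bp !scale0r mulmx0 mulmx1 !mul0rn !addr0.
    by case: i; rewrite /= -?LE ?Pp2 ?add0r ?addr0.
  have [->|vq] := eqVneq v q.
    rewrite fq gq aq bq !scale0r mulmx0 mulmx1 !mul0rn !addr0.
    by case: j; rewrite /= -?LE ?Pq2 ?add0r ?addr0.
  rewrite fE gE (negbTE vp) (negbTE vq) !addr0 !mul_mx_scalar -LE.
  by rewrite addrAC.
have indf i j : indep Lam (wface2 p q i j).
  apply: functional_indep (fp i) (fq j) (gp i) (gq j).
  by case: i; case: j; rewrite //= (inj_eq Some_inj).
have indE i j (t : {set V}) :
    indep Lam (wface2 p q i j :|: wcopy2 p q i j @: t) <-> indep (M i j) t.
  have := quotient_indep t (@wcopy2_inj V p q i j) _ (quoQ i j).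
  move=> /(_ (wcopy2_notin pq i j))[to from].
  rewrite ME; split=> [/to[_] | ind].
    by apply: eq_indep => v; rewrite ffunE.
  apply: from; split=> //; apply: eq_indep ind => v; by rewrite ffunE.
split=> [i j|]; first by rewrite (Proj_dj_class _ (quoQ i j)) -ME.
split=> [/(characteristic_wedge2 _ _ pq) ind i j | ind].
  by apply/characteristicP => t tK; apply/indE/ind.
apply/(characteristic_wedge2 _ _ pq) => i j t tK; apply/indE.
by move/characteristicP: (ind i j); apply.
Qed.

End WedgeMaps.

(** * Normal forms of adjacent pairs and of realizable squares *)

Section Adjacency.

Variables (V : finType) (n : nat) (K : {set {set V}}).
Hypothesis vertexK : forall v : V, [set v] \in K.
Implicit Types (L : {ffun V -> 'cV['F_2]_n}) (p q : V).

Lemma characteristic_neq0 L p : characteristic K L -> L p != 0.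
Proof. by move/characteristicP => indL; apply/indep1/indL. Qed.

(** Each of the pairs among p_1, p_2 and q is a face of the wedge at p, whether
    or not p and q span a face of K; this gives the coordinate f that is 1 on
    p_1 and p_2 and 0 on q. *)
Lemma adjacent_shear p q L la :
  p != q -> adjacent K p (dj_class L) la ->
  exists a : V -> 'F_2, [/\ a p = 0, a q = 0, la = dj_class (shear L (L p) a)
    & characteristic K (shear L (L p) a)].
Proof.
move=> pq [_ [/imsetP[Lam0 char0 ->] Proj2 Proj1]]; rewrite inE in char0.
have [Lam [P [LamE quoP LE]]] := Proj_representative Proj2.
have {}LE v : L v = P *m Lam (Some v) by rewrite LE wcopy_false.
have {char0} charLam : characteristic (wedge K p) Lam.
  by apply: characteristic_dj char0; rewrite -LamE mem_dj_class.
have ind := (iffLR (characteristic_wedge _ _ _) charLam).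
have sub i v : indep Lam (wvertex p i |: (wcopy p i v |: set0)).
  by rewrite setU0 -(imset_set1 (wcopy p i)); apply: ind.
have [|||||||f [f2 f1 fq _]] :=
  @three_faces_functional _ _ Lam set0 None (Some p) (Some q).
- by rewrite /= !inE (inj_eq Some_inj) pq.
- by rewrite inE.
- by rewrite inE.
- by rewrite inE.
- by have := sub false p; rewrite wcopy_false.
- by have := sub true q; rewrite /wcopy eq_sym (negbTE pq).
- by have := sub false q; rewrite wcopy_false.
pose a v : 'F_2 := (f *m Lam (Some v)) 0 0 - (v == p)%:R.
have fE v : f *m Lam (Some v) = (a v + (v == p)%:R)%:M.
  by rewrite [LHS]mx11_scalar subrK.
have ap : a p = 0 by rewrite /a f1 eqxx mxE subrr.
have aq : a q = 0 by rewrite /a fq eq_sym (negbTE pq) mxE subrr.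
have [_ Proj1' charE] := wedge_shear K quoP LE f2 ap fE.
exists a; split=> //; first by rewrite -Proj1 -LamE Proj1'.
by case/charE: charLam.
Qed.

Lemma shear_adjacent p L (a : V -> 'F_2) :
  characteristic K L -> a p = 0 -> characteristic K (shear L (L p) a) ->
  adjacent K p (dj_class L) (dj_class (shear L (L p) a)).
Proof.
move=> charL ap charA.
(* The first coordinate is f, the last n are P; p_2 is the first unit vector. *)
pose Lam : {ffun option V -> 'cV['F_2]_(1 + n)} := [ffun x =>
  if x is Some v then col_mx (a v + (v == p)%:R)%:M (L v) else col_mx 1%:M 0].
pose P : 'M['F_2]_(n, 1 + n) := row_mx 0 1%:M.
pose f : 'rV['F_2]_(1 + n) := row_mx 1%:M 0.
have [|||||Proj2 Proj1 charE] := @wedge_shear V n _ K p L P f a Lam; rewrite //.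
- split=> [|x].
    by apply/row_freeP; exists (col_mx 0 1%:M);
      rewrite mul_row_col mulmx0 mul1mx add0r.
  rewrite -[x]vsubmxK mul_row_col mul0mx mul1mx add0r.
  apply/eqP/span_imageP => [-> | [c]].
    exists (fun=> usubmx x 0 0); rewrite big_set1 ffunE scale_col_mx scaler0.
    by rewrite scalemx1 -mx11_scalar.
  by rewrite big_set1 ffunE scale_col_mx scaler0 => /eq_col_mx[].
- by move=> v; rewrite ffunE mul_row_col mul0mx mul1mx add0r.
- by rewrite ffunE mul_row_col mul0mx mul1mx addr0.
- by move=> v; rewrite ffunE mul_row_col mul0mx mul1mx addr0.
exists (dj_class Lam); split=> //.
by apply/mem_CM/charE.
Qed.

(** Any two of p_1, p_2, q_1 span a face together with q_2, and any two of
    q_1, q_2, p_1 span one together with p_2; this gives the two coordinates. *)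
Lemma realizable_square p q L la lb lc :
  p != q -> realizable K p q (dj_class L) la lb lc ->
  exists a b : V -> 'F_2, [/\ [/\ a p = 0, a q = 0, b p = 0 & b q = 0],
    la = dj_class (square L p q a b true false),
    lb = dj_class (square L p q a b false true)
    & lc = dj_class (square L p q a b true true)].
Proof.
move=> pq [_ [/imsetP[Lam0 char0 ->] [Proj00 Proj10 Proj01 Proj11]]].
rewrite inE in char0.
have qp : q != p by rewrite eq_sym.
have [Lam [P [LamE quoP LE]]] := Proj_representative Proj00.
have {}LE v : L v = P *m Lam (Some (Some v)).
  by rewrite LE wcopy2E //=; do 2?case: eqP => [->|_].
have {char0} charLam : characteristic (wedge2 K p q) Lam.
  by apply: characteristic_dj char0; rewrite -LamE mem_dj_class.
have ind := iffLR (characteristic_wedge2 _ _ pq) charLam.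
have sub i j v :
    indep Lam [set wcopy2 p q i j v; Some (wvertex p i); wvertex (Some q) j].
  rewrite -setUA setUC -(imset_set1 (wcopy2 p q i j)); exact: ind.
have [|||||||f [fp2 fp1 fq1 fq2]] :=
  @three_faces_functional _ _ Lam [set None]
    (Some None) (Some (Some p)) (Some (Some q)).
- by rewrite /= !inE !(inj_eq Some_inj) pq.
- by rewrite inE.
- by rewrite inE.
- by rewrite inE.
- have := sub false false p; rewrite wcopy2E // eqxx /=.
  by rewrite -setUA setUCA.
- have := sub true false q; rewrite wcopy2E // eqxx (negbTE qp) /=.
  by rewrite -setUA setUCA.
- have := sub false false q; rewrite wcopy2E // eqxx (negbTE qp) /=.
  by rewrite -setUA setUCA.
have [|||||||g [gq2 gq1 gp1 gp2]] :=
  @three_faces_functional _ _ Lam [set Some None]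
    None (Some (Some q)) (Some (Some p)).
- by rewrite /= !inE !(inj_eq Some_inj) qp.
- by rewrite inE.
- by rewrite inE.
- by rewrite inE.
- have := sub false false q; rewrite wcopy2E // eqxx (negbTE qp) /=.
  by rewrite setUC setUCA [X in _ :|: X]setUC setUCA setUA.
- have := sub false true p; rewrite wcopy2E // eqxx /=.
  by rewrite setUC [X in _ :|: X]setUC.
- have := sub false false p; rewrite wcopy2E // eqxx /=.
  by rewrite setUC [X in _ :|: X]setUC.
have {}fq2 := fq2 _ (set11 _); have {}gp2 := gp2 _ (set11 _).
pose a v : 'F_2 := (f *m Lam (Some (Some v))) 0 0 - (v == p)%:R.
pose b v : 'F_2 := (g *m Lam (Some (Some v))) 0 0 - (v == q)%:R.
have fE v : f *m Lam (Some (Some v)) = (a v + (v == p)%:R)%:M.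
  by rewrite [LHS]mx11_scalar subrK.
have gE v : g *m Lam (Some (Some v)) = (b v + (v == q)%:R)%:M.
  by rewrite [LHS]mx11_scalar subrK.
have ab0 : [/\ a p = 0, a q = 0, b p = 0 & b q = 0].
  by rewrite /a /b fp1 fq1 gp1 gq1 !eqxx (negbTE pq) (negbTE qp) !mxE !subrr.
have [ProjE _] := wedge2_square K pq quoP LE ab0 fp2 fq2 gp2 gq2 fE gE.
by exists a, b; split; rewrite // -ProjE LamE.
Qed.

Lemma square_realizable p q L (a b : V -> 'F_2) :
  p != q -> [/\ a p = 0, a q = 0, b p = 0 & b q = 0] ->
  (forall i j, characteristic K (square L p q a b i j)) ->
  realizable K p q (dj_class L) (dj_class (square L p q a b true false))
    (dj_class (square L p q a b false true)) (dj_class (square L p q a b true true)).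
Proof.
move=> pq ab0 charS.
(* The coordinates are f, g and P; p_2 and q_2 are the first two unit vectors. *)
pose Lam : {ffun option (option V) -> 'cV['F_2]_(1 + (1 + n))} := [ffun x =>
  match x with
  | Some (Some v) =>
      col_mx (a v + (v == p)%:R)%:M (col_mx (b v + (v == q)%:R)%:M (L v))
  | Some None => col_mx 1%:M (col_mx 0 0)
  | None => col_mx 0 (col_mx 1%:M 0)
  end].
pose P : 'M['F_2]_(n, 1 + (1 + n)) := row_mx 0 (row_mx 0 1%:M).
pose f : 'rV['F_2]_(1 + (1 + n)) := row_mx 1%:M (row_mx 0 0).
pose g : 'rV['F_2]_(1 + (1 + n)) := row_mx 0 (row_mx 1%:M 0).
pose simp := (mul_row_col, mul0mx, mulmx0, mul1mx, add0r, addr0).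
have [||||||||ProjE charE] := @wedge2_square V n _ K p q L P f g a b Lam pq _ _ ab0;
  rewrite //; try by rewrite ffunE !simp.
- split=> [|x].
    by apply/row_freeP; exists (col_mx 0 (col_mx 0 1%:M)); rewrite !simp.
  rewrite -[x]vsubmxK -[dsubmx x]vsubmxK !simp.
  apply/eqP/span_imageP => [-> | [c]].
    exists (fun w => if w is None then usubmx (dsubmx x) 0 0 else usubmx x 0 0).
    rewrite big_setU1 ?inE // big_set1 /= !ffunE.
    rewrite !scale_col_mx !scaler0 !add_col_mx !simp.
    by rewrite !scalemx1 -!mx11_scalar.
  rewrite big_setU1 ?inE // big_set1 /= !ffunE.
  rewrite !scale_col_mx !scaler0 !add_col_mx !simp => /eq_col_mx[_].
  by move=> /eq_col_mx[].
- by move=> v; rewrite ffunE !simp.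
- by move=> v; rewrite ffunE !simp.
- by move=> v; rewrite ffunE !simp.
exists (dj_class Lam); split; first exact/mem_CM/charE.
rewrite !ProjE; split=> //; congr dj_class.
by apply/ffunP => v; rewrite ffunE !mulr0n !addr0.
Qed.

End Adjacency.

(** * Uniqueness of the normal forms *)

Section Gauge.

Variables (V : finType) (n : nat).
Implicit Types (L M : {ffun V -> 'cV['F_2]_n}) (p q : V) (a b : V -> 'F_2).
Implicit Types (c d : 'rV['F_2]_n).

Lemma shear_squareE L p q a b :
  shear (shear L (L p) a) (L q) b = square L p q a b true true.
Proof. by apply/ffunP => v; rewrite !ffunE. Qed.

Lemma square_sym L p q a b i j : square L p q a b i j = square L q p b a j i.
Proof. by apply/ffunP => v; rewrite !ffunE addrAC. Qed.

Lemma square_p L p q a b : square L p q a b true false = shear L (L p) a.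
Proof. by apply/ffunP => v; rewrite !ffunE mulr0n addr0. Qed.

Lemma square_q L p q a b : square L p q a b false true = shear L (L q) b.
Proof. by apply/ffunP => v; rewrite !ffunE mulr0n addr0. Qed.

Lemma square_id L p q a b : square L p q a b false false = L.
Proof. by apply/ffunP => v; rewrite !ffunE !mulr0n !addr0. Qed.

Lemma shear_fix L x a v : a v = 0 -> shear L x a v = L v.
Proof. by move=> av; rewrite ffunE av scale0r addr0. Qed.

(** The transvection 1 + x c carries one map to the other. *)
Lemma shear_gauge M (x : 'cV['F_2]_n) a a' c :
  c *m x = 0 -> (forall v, (a' v)%:M = (a v)%:M + c *m M v) ->
  dj_class (shear M x a') = dj_class (shear M x a).
Proof.
move=> cx aE; apply: dj_class_eq; apply/dj_classP; exists (1%:M + x *m c).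
  have /mulmx1_unit[] // : (1%:M + x *m c) *m (1%:M - x *m c) = 1%:M.
  rewrite mulmxDl mul1mx mulmxBr mulmx1 -mulmxA (mulmxA c) cx mul0mx mulmx0.
  by rewrite subr0 subrK.
move=> v; rewrite !ffunE mulmxDl mul1mx -mulmxA mulmxDr -scalemxAr cx scaler0.
by rewrite addr0 -!mul_mx_scalar aE mulmxDr addrA.
Qed.

Lemma square_gauge L p q a a' b b' c d :
  c *m L p = 0 -> c *m L q = 0 -> d *m L p = 0 -> d *m L q = 0 ->
  (forall v, (a' v)%:M = (a v)%:M + c *m L v) ->
  (forall v, (b' v)%:M = (b v)%:M + d *m L v) ->
  dj_class (square L p q a' b' true true) = dj_class (square L p q a b true true).
Proof.
move=> cp cq dp dq aE bE; rewrite -shear_squareE.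
rewrite (@shear_gauge _ _ b b' d) // => [|v]; last first.
  by rewrite bE ffunE mulmxDr -scalemxAr dp scaler0 addr0.
rewrite shear_squareE square_sym [in RHS]square_sym -!shear_squareE.
apply: (@shear_gauge _ _ a a' c) => // v.
by rewrite aE ffunE mulmxDr -scalemxAr cq scaler0 addr0.
Qed.

(** The matrix g relating the two maps fixes L p and is the identity modulo L p;
    the form c is the L p component of g - 1. *)
Lemma shear_same_class L p q a a' :
  L p != 0 -> a p = 0 -> a q = 0 -> a' p = 0 -> a' q = 0 ->
  shear L (L p) a' \in dj_class (shear L (L p) a) ->
  exists c, [/\ c *m L p = 0, c *m L q = 0
    & forall v, (a' v)%:M = (a v)%:M + c *m L v].
Proof.
move=> /indep_set1/(indep_functional (fun=> 1))[f /(_ p (set11 p)) fp] ap aq a'p a'q.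
case/dj_classP=> g _ gE.
have gp : g *m L p = L p by have := gE p; rewrite !shear_fix.
have cE v : (a' v)%:M = (a v)%:M + f *m (g - 1%:M) *m L v.
  (* Apply f, which is 1 at L p, to g (L v + a v L p) = L v + a' v L p. *)
  have := congr1 (mulmx f) (gE v).
  rewrite !ffunE !mulmxDr -!scalemxAr gp fp !scalemx1 mulmxN mulmx1 mulmxBl.
  by rewrite -mulmxA => fgv; rewrite addrA [X in X - _]addrC -fgv addrC addKr.
exists (f *m (g - 1%:M)); split=> //.
  by have := cE p; rewrite ap a'p raddf0 add0r.
by have := cE q; rewrite aq a'q raddf0 add0r.
Qed.

(** The matrix g relating the two maps is the identity modulo L p and L q and
    fixes both; the form d is the L q component of g - 1. *)
Lemma square_same_class L p q a a' b b' :
  indep L [set p; q] -> p != q ->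
  [/\ a p = 0, a q = 0, b p = 0 & b q = 0] ->
  [/\ a' p = 0, a' q = 0, b' p = 0 & b' q = 0] ->
  square L p q a' b' true true \in dj_class (square L p q a b true true) ->
  exists d, [/\ d *m L p = 0, d *m L q = 0
    & forall v, (b' v)%:M = (b v)%:M + d *m L v].
Proof.
move=> ind pq [ap aq bp bq] [a'p a'q b'p b'q] /dj_classP[g _ gE].
have [f fE] := indep_functional (fun v => (v == q)%:R) ind.
have fp : f *m L p = 0 by rewrite fE ?inE ?eqxx // (negbTE pq) raddf0.
have fq : f *m L q = 1%:M by rewrite fE ?inE ?eqxx ?orbT.
have gp : g *m L p = L p.
  by have := gE p; rewrite -!shear_squareE !shear_fix.
have gq : g *m L q = L q.
  by have := gE q; rewrite -!shear_squareE !shear_fix.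
have dE v : (b' v)%:M = (b v)%:M + f *m (g - 1%:M) *m L v.
  have := congr1 (mulmx f) (gE v).
  rewrite -!shear_squareE !ffunE !mulmxDr -!scalemxAr gp gq fp fq !scaler0 !addr0.
  rewrite !scalemx1 mulmxN mulmx1 mulmxBl -mulmxA => fgv.
  by rewrite addrA [X in X - _]addrC -fgv addrC addKr.
exists (f *m (g - 1%:M)); split=> //.
  by have := dE p; rewrite bp b'p raddf0 add0r.
by have := dE q; rewrite bq b'q raddf0 add0r.
Qed.

Lemma normalizedP p q L A : L p != 0 ->
  normalized p q L A <->
  exists a, [/\ a p = 0, a q = 0 & A = shear L (L p) a].
Proof.
move=> Lp0; split=> [/and3P[/eqP Ap /eqP Aq /forallP Adiff] | [a [ap aq ->]]].
  have /fin_all_exists[a aE] v : exists x : 'F_2, A v - L v = x *: L p.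
    by have /vlineP[x ->] := Adiff v; exists x.
  exists a; split.
  - by have := aE p; rewrite Ap subrr => /esym/eqP;
      rewrite scaler_eq0 (negbTE Lp0) orbF => /eqP.
  - by have := aE q; rewrite Aq subrr => /esym/eqP;
      rewrite scaler_eq0 (negbTE Lp0) orbF => /eqP.
  by apply/ffunP => v; rewrite ffunE -aE addrC subrK.
apply/and3P; split; rewrite ?shear_fix //.
apply/forallP => v; rewrite ffunE addrC addKr.
by apply/memvZ/memv_line.
Qed.

(** Whichever normalized representative is picked, its coefficients agree with
    the given ones up to a linear form. *)
Lemma normalizeP p q L A a :
  L p != 0 -> a p = 0 -> a q = 0 -> A \in dj_class (shear L (L p) a) ->
  exists a', [/\ a' p = 0, a' q = 0, normalize p q L A = shear L (L p) a'
    & exists c, [/\ c *m L p = 0, c *m L q = 0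
        & forall v, (a' v)%:M = (a v)%:M + c *m L v]].
Proof.
move=> Lp0 ap aq AE; rewrite /normalize (dj_class_eq AE).
case: pickP => [A' /andP[A'E] | /(_ (shear L (L p) a))].
  move=> /(normalizedP _ _ Lp0)[a' [a'p a'q A'shear]].
  exists a'; split; rewrite //= -?A'shear //.
  by apply: shear_same_class; rewrite // -A'shear.
rewrite mem_dj_class /= => /negP[]; apply/normalizedP => //.
by exists a.
Qed.

End Gauge.

(** * The missing piece *)

Section MissingPiece.

Variables (V : finType) (n : nat) (K : {set {set V}}).
Hypothesis vertexK : forall v : V, [set v] \in K.
Variables (p q : V).
Hypothesis pq : p != q.
Implicit Types (l la lb lc : {set {ffun V -> 'cV['F_2]_n}}).

Lemma realizable_computed l la lb lc :
  l \in CM n K -> realizable K p q l la lb lc -> computed p q l la lb lc.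
Proof.
move=> lCM real L A B lL; have [charL lE] := CM_characteristic lCM lL.
rewrite lE in real.
have [Lp0 Lq0] := (characteristic_neq0 vertexK p charL,
                   characteristic_neq0 vertexK q charL).
have [a [b [[ap aq bp bq] -> -> ->]]] := realizable_square vertexK pq real.
rewrite square_p square_q.
move=> /(normalizeP Lp0 ap aq)[a' [a'p a'q AE [c [cp cq cE]]]].
move=> /(normalizeP Lq0 bq bp)[b' [b'q b'p BE [d [dq dp dE]]]].
rewrite -(square_gauge cp cq dp dq cE dE); congr dj_class.
rewrite /completion AE BE; apply/ffunP => v.
by rewrite !ffunE (addrA (L v) (L v)) addmxx_F2 add0r addrCA addrA.
Qed.

(** Put x = L p = L q.  A relation with coefficients c on a face of K reads
    sum c L + (sum c a + sum c b) x = 0.  If sum c a = 0 it is a relation for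
    L + b x, if sum c b = 0 one for L + a x, and if both are 1 one for L. *)
Lemma dependent_square_characteristic (L : {ffun V -> 'cV['F_2]_n})
    (a b : V -> 'F_2) :
  L p = L q -> characteristic K L -> characteristic K (shear L (L p) a) ->
  characteristic K (shear L (L q) b) ->
  characteristic K (square L p q a b true true).
Proof.
move=> LpE /characteristicP indL /characteristicP indA /characteristicP indB.
apply/characteristicP => s sK c.
pose S := \sum_(v in s) c v *: L v.
have shearE (e : V -> 'F_2) : \sum_(v in s) c v *: shear L (L q) e v =
    S + (\sum_(v in s) c v * e v) *: L q.
  rewrite scaler_suml -big_split /=; apply: eq_bigr => v _.
  by rewrite ffunE scalerDr scalerA.
have -> : square L p q a b true true = shear L (L q) (fun v => a v + b v).
  by apply/ffunP => v; rewrite !ffunE LpE scalerDl addrA.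
rewrite LpE in indA; rewrite shearE => sum0.
have [a0 | /F2_neq0 a1] := eqVneq (\sum_(v in s) c v * a v) 0.
  apply: (indB s sK); rewrite shearE -[RHS]sum0; congr (_ + _ *: _).
  under [RHS]eq_bigr do rewrite mulrDr.
  by rewrite big_split /= a0 add0r.
have [b0 | /F2_neq0 b1] := eqVneq (\sum_(v in s) c v * b v) 0.
  apply: (indA s sK); rewrite shearE -[RHS]sum0; congr (_ + _ *: _).
  under [RHS]eq_bigr do rewrite mulrDr.
  by rewrite big_split /= b0 addr0.
apply: (indL s sK); rewrite -[RHS]sum0 -/S.
under eq_bigr do rewrite mulrDr.
by rewrite big_split /= a1 b1 (_ : 1 + 1 = 0) ?scale0r ?addr0 //; apply: val_inj.
Qed.

(** Only the characteristic property of the fourth corner is at stake, by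
    [square_realizable]. *)
Lemma missing_piece_exists l la lb lc0 :
  incomplete_square K p q l la lb -> possible_missing_piece K p q la lb lc0 ->
  exists lc, missing_piece K p q l la lb lc.
Proof.
have qp : q != p by rewrite eq_sym.
case=> lCM _ _ adjA adjB [lc0CM adjAC adjBC].
have [L lL] : exists L, L \in l.
  by case/imsetP: lCM => L _ ->; exists L; apply: mem_dj_class.
have [charL lE] := CM_characteristic lCM lL.
rewrite {}lE in adjA adjB *; move: adjAC adjBC.
have [a [ap aq -> charA]] := adjacent_shear vertexK pq adjA.
have [b [bq bp -> charB]] := adjacent_shear vertexK qp adjB.
move=> adjAC adjBC.
have [b' [b'q b'p lc0A charC]] := adjacent_shear vertexK qp adjAC.
have [a' [a'p a'q lc0B _]] := adjacent_shear vertexK pq adjBC.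
rewrite (shear_fix _ _ aq) shear_squareE in lc0A charC.
rewrite (shear_fix _ _ bp) shear_squareE square_sym in lc0B.
have charS : characteristic K (square L p q a b true true).
  have [LpE | LpN] := eqVneq (L p) (L q).
    exact: dependent_square_characteristic.
  have ind : indep L [set p; q].
    by apply: indep_set2 => //; apply: characteristic_neq0 charL.
  have sameC : square L p q a b' true true
      \in dj_class (square L p q a' b true true).
    by rewrite -lc0B lc0A mem_dj_class.
  have [d [dp dq dE]] := square_same_class ind pq
    (And4 a'p a'q bp bq) (And4 ap aq b'p b'q) sameC.
  apply: characteristic_dj charC.
  have aE v : (a v)%:M = (a v)%:M + 0 *m L v by rewrite mul0mx addr0.
  by rewrite (square_gauge (mul0mx _ _) (mul0mx _ _) dp dq aE dE) mem_dj_class.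
exists (dj_class (square L p q a b true true)); split; first split.
- exact: mem_CM.
- have := shear_adjacent charA bq.
  by rewrite (shear_fix _ _ aq) shear_squareE; apply.
- have := shear_adjacent charB ap.
  by rewrite (shear_fix _ _ bp) shear_squareE square_sym; apply.
rewrite -(square_p L p q a b) -(square_q L p q a b).
apply: (square_realizable pq (And4 ap aq bp bq)) => i j; case: i; case: j.
- exact: charS.
- by rewrite square_p.
- by rewrite square_q.
- by rewrite square_id.
Qed.

End MissingPiece.

Theorem lemma4p6 (R : realType) (m n : nat) (K : {set {set 'I_m}})
  (hK : simplicial_complex_on K) (hpure : pure n K) (hPL : PL_sphere R n K)
  (p q : 'I_m) (hpq : p != q)
  (l la lb : {set {ffun 'I_m -> 'cV['F_2]_n}})
  (hsq : incomplete_square K p q l la lb) :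
  [/\ (forall lc, ~ possible_missing_piece K p q la lb lc) ->
        forall lc, ~ missing_piece K p q l la lb lc,
      (exists lc1 lc2, [/\ lc1 <> lc2,
          possible_missing_piece K p q la lb lc1
        & possible_missing_piece K p q la lb lc2]) ->
        exists lc, [/\ possible_missing_piece K p q la lb lc,
                       unique (missing_piece K p q l la lb) lc
                     & computed p q l la lb lc]
    & forall lc, unique (possible_missing_piece K p q la lb) lc ->
        unique (missing_piece K p q l la lb) lc /\ computed p q l la lb lc].
Proof.
have [lCM laCM lbCM _ _] := hsq; have [_ vertexK] := hK.
have computedP lc : missing_piece K p q l la lb lc -> computed p q l la lb lc.
  by case=> _; apply: realizable_computed.
have uniqueP lc : missing_piece K p q l la lb lc ->
    unique (missing_piece K p q l la lb) lc.
  move=> lcM; split=> // lc' lc'M.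
  case/imsetP: lCM (computedP _ lcM) (computedP _ lc'M) => L _ ->.
  case/imsetP: laCM => A _ ->; case/imsetP: lbCM => B _ -> lcE lc'E.
  by rewrite (lcE L A B) ?(lc'E L A B) ?mem_dj_class.
split=> [none lc [lcP _] | [lc1 [_ [_ lc1P _]]] | lc [lcP lc_uniq]].
- exact: none lcP.
- have [lc lcM] := missing_piece_exists vertexK hpq hsq lc1P.
  by exists lc; split; [case: lcM | apply: uniqueP | apply: computedP].
have [lc' lc'M] := missing_piece_exists vertexK hpq hsq lcP.
have -> : lc = lc' by apply: lc_uniq; case: lc'M.
by split; [apply: uniqueP | apply: computedP].
Qed.
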